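(* Let $k$ be a field, $n,s\ge 1$ integers, $R=k[x_1,\dots,x_n]$. Let $J_1,\dots,J_s$ be nonempty subsets of $[n]=\{1,\dots,n\}$ such that $J_i\cup J_j=[n]$ for all $i\neq j$, let $a_1,\dots,a_s$ be positive integers, and let $$I=\mathfrak m_{J_1}^{a_1}\cap\cdots\cap\mathfrak m_{J_s}^{a_s}\subset R.$$ Then $(I_d)$ is polymatroidal for all $d$, and hence $I$ is componentwise linear.
   Context: For a nonempty subset $J=\{j_1,\dots,j_t\}\subseteq[n]$, $\mathfrak m_J=(x_{j_1},\dots,x_{j_t})\subset R$. $R$ is standard graded. For a homogeneous ideal $I$, $(I_d)$ is the ideal of $R$ generated by all elements of $I$ of degree $d$. A homogeneous ideal generated in degree $d$ has a linear resolution if its graded Betti numbers satisfy $\beta_{i,j}=0$ for all $i\ge 0$ and $j\neq i+d$. A homogeneous ideal $I$ is componentwise linear if $(I_d)$ has a linear resolution for every $d$ (the zero ideal counts as having a linear resolution). A monomial ideal $L$ generated in a single degree is polymatroidal if its minimal monomial generators satisfy the exchange property: if $u=x_1^{a_1}\cdots x_n^{a_n}$ and $v=x_1^{b_1}\cdots x_n^{b_n}$ are minimal generators of $L$, then for each $i$ with $a_i>b_i$ there exists $j$ with $a_j<b_j$ such that $x_ju/x_i\in L$. (The zero ideal is vacuously polymatroidal.) *)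

(* Defs.v *)
From HB Require Import structures.
From mathcomp Require Import all_boot all_order all_algebra.
From mathcomp Require Import mpoly.

Set Implicit Arguments.
Unset Strict Implicit.
Unset Printing Implicit Defensive.

Import GRing.Theory.
Local Open Scope ring_scope.

(* Ideals of {mpoly k[n]} are represented by their membership predicates.
   (MathComp's [ring_quotient] ideals are boolean and proper, hence exclude
   general ideals of this kind.) *)

Section Ideals.
Variables (k : fieldType) (n : nat).
Local Notation R := {mpoly k[n]}.
Implicit Types (S I L : R -> Prop) (J : {set 'I_n}).

Definition ideal_gen S : R -> Prop := fun f =>
  exists (r : nat) (c g : 'I_r -> R),
    (forall i, S (g i)) /\ f = \sum_(i < r) c i * g i.

Definition ideal_eq I L : Prop := forall f, I f <-> L f.

Definition ideal_pow I (a : nat) : R -> Prop :=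
  ideal_gen (fun f =>
    exists g : 'I_a -> R, (forall i, I (g i)) /\ f = \prod_(i < a) g i).

Definition ideal_inter (s : nat) (Is : 'I_s -> R -> Prop) : R -> Prop :=
  fun f => forall i, Is i f.

Definition var_ideal J : R -> Prop :=
  ideal_gen (fun f => exists2 j, j \in J & f = 'X_j).

(* The ideal (I_d); note that 0 \is d.-homog for every d. *)
Definition degree_ideal I (d : nat) : R -> Prop :=
  ideal_gen (fun f => I f /\ f \is d.-homog).

Definition homogeneous_ideal I : Prop :=
  exists2 S : R -> Prop,
    (forall f, S f -> exists d : nat, f \is d.-homog) & ideal_eq I (ideal_gen S).

Definition generated_in_degree L (d : nat) : Prop :=
  exists2 S : R -> Prop,
    (forall f, S f -> f \is d.-homog) & ideal_eq L (ideal_gen S).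

Definition monomial_ideal L : Prop :=
  exists M : 'X_{1..n} -> Prop,
    ideal_eq L (ideal_gen (fun f => exists2 m, M m & f = 'X_[m])).

(* [(m' <= m)%MM] is divisibility of monomials, not a monomial order. *)
Definition min_monomial_gen L (m : 'X_{1..n}) : Prop :=
  L 'X_[m] /\ forall m' : 'X_{1..n}, L 'X_[m'] -> (m' <= m)%MM -> m' = m.

Definition polymatroidal L : Prop :=
  [/\ monomial_ideal L,
      exists d : nat, generated_in_degree L d
    & forall u v : 'X_{1..n}, min_monomial_gen L u -> min_monomial_gen L v ->
      forall i : 'I_n, (v i < u i)%N ->
      exists2 j : 'I_n, (u j < v j)%N & L 'X_[(u - U_(i) + U_(j))%MM]].

(* A sequence of graded free modules F_i = (+)_l R(- shift i l) and of maps
     ... -> F_2 -> F_1 -> F_0 -> R.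
   Elements of F_i are row vectors: F_{i+1} -> F_i is v |-> v *m diff i and
   F_0 -> R is v |-> v *m aug. *)
Record free_complex := FreeComplex {
  rk : nat -> nat;
  shift : forall i, 'I_(rk i) -> nat;
  diff : forall i, 'M[R]_(rk i.+1, rk i);
  aug : 'cV[R]_(rk 0)
}.

(* All maps are homogeneous of degree 0. The inequality between the shifts
   must be stated because subtraction on nat is truncated. *)
Definition graded_complex (F : free_complex) : Prop :=
  (forall l, aug F l 0 \is (shift (f := F) l).-homog) /\
  (forall i l m, diff F i l m != 0 ->
     (shift (f := F) m <= shift (f := F) l)%N /\
     diff F i l m \is (shift (f := F) l - shift (f := F) m).-homog).

Definition resolves (F : free_complex) I : Prop :=
  [/\ forall f, I f <-> exists v : 'rV[R]_(rk F 0), f = (v *m aug F) 0 0,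
      forall v : 'rV[R]_(rk F 0),
        v *m aug F = 0 <-> exists w : 'rV[R]_(rk F 1), v = w *m diff F 0
    & forall i (v : 'rV[R]_(rk F i.+1)),
        v *m diff F i = 0 <-> exists w : 'rV[R]_(rk F i.+2), v = w *m diff F i.+1].

(* The image of F_{i+1} lies in (x_1, ..., x_n) F_i. *)
Definition minimal_complex (F : free_complex) : Prop :=
  forall i l m, var_ideal [set: 'I_n] (diff F i l m).

Definition minimal_graded_resolution (F : free_complex) I : Prop :=
  [/\ graded_complex F, resolves F I & minimal_complex F].

(* beta_{i,j}(I) = b, where beta_{i,j}(I) is the number of copies of R(-j) in
   homological degree i of a minimal graded free resolution of I. Such a
   resolution exists for every homogeneous I and is unique up to isomorphism,
   so this relation is functional in b. Shifts are natural numbers, since an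
   ideal of R has no nonzero Betti number in negative internal degree. *)
Definition graded_betti I (i j b : nat) : Prop :=
  exists2 F : free_complex, minimal_graded_resolution F I
    & b = #|[set l : 'I_(rk F i) | shift l == j]|.

Definition linear_resolution L (d : nat) : Prop :=
  generated_in_degree L d /\
  forall i j : nat, j <> (i + d)%N -> graded_betti L i j 0.

Definition componentwise_linear I : Prop :=
  homogeneous_ideal I /\ forall d : nat, linear_resolution (degree_ideal I d) d.

End Ideals.

Arguments var_ideal k {n} J.

(* Main.v *)
Require Import Defs.
From HB Require Import structures.
From mathcomp Require Import all_boot all_order all_algebra.
From mathcomp Require Import mpoly.
From Stdlib Require ClassicalEpsilon.

(* In degree d the monomials of I are those u of degree d with
   deg_{J_t} u >= a_t for all t; as the complements of the J_t are pairwise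
   disjoint, these satisfy the exchange property.

   By exchange, listing these monomials lexicographically gives linear
   quotients: each colon ideal of a generator by the preceding ones is generated
   by variables. This property passes to syzygies. If row l of a matrix has
   colon ideal (x_j : j in V l), the syzygy module is generated by one linear
   relation for each pair (l, j) with j in V l, with entry x_j at position l
   and otherwise supported on earlier positions, and these relations again have
   linear quotients, with colon ideal (x_j' : j' in V l, j' < j) at (l, j).
   Iterating produces an infinite complex of linear matrices, which is the linear
   minimal resolution. *)

(** * Generated ideals and membership read off the support *)

Section IdealGen.
Set Implicit Arguments.
Unset Strict Implicit.
Import GRing.Theory.
Local Open Scope ring_scope.

Variables (k : fieldType) (n : nat).
Local Notation R := {mpoly k[n]}.
Implicit Types (S P : R -> Prop) (f g : R) (m : 'X_{1..n}).

Definition ideal_closed P : Prop :=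
  [/\ P 0, forall f g, P f -> P g -> P (f + g) & forall c f, P f -> P (c * f)].

Lemma ideal_gen_incl S f : S f -> ideal_gen S f.
Proof.
by move=> Sf; exists 1%N, (fun=> 1), (fun=> f); split=> //; rewrite big_ord1 mul1r.
Qed.

Lemma ideal_gen_closed S : ideal_closed (ideal_gen S).
Proof.
split.
- exists 0%N, (fun=> 0), (fun=> 0); split; first by case.
  by rewrite big_ord0.
- move=> _ _ [r1 [c1 [g1 [S1 ->]]]] [r2 [c2 [g2 [S2 ->]]]].
  pose cat (h1 : 'I_r1 -> R) (h2 : 'I_r2 -> R) i :=
    match split i with inl a => h1 a | inr b => h2 b end.
  exists (r1 + r2)%N, (cat c1 c2), (cat g1 g2); split.
    by move=> i; rewrite /cat; case: split.
  rewrite big_split_ord; congr (_ + _); apply: eq_bigr => i _.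
    by rewrite /cat !(unsplitK (inl i)).
  by rewrite /cat !(unsplitK (inr i)).
- move=> c _ [r [b [g [Sg ->]]]]; exists r, (fun i => c * b i), g; split=> //.
  by rewrite mulr_sumr; apply: eq_bigr => i _; rewrite mulrA.
Qed.

Lemma ideal_closed_sum P (T : Type) (r : seq T) (Q : pred T) (F : T -> R) :
  ideal_closed P -> (forall i, Q i -> P (F i)) -> P (\sum_(i <- r | Q i) F i).
Proof. by case=> P0 PD _ PF; apply: (big_ind P). Qed.

Lemma ideal_gen_min S P f :
  ideal_closed P -> (forall g, S g -> P g) -> ideal_gen S f -> P f.
Proof.
move=> Pcl SP [r [c [g [Sg ->]]]]; apply: ideal_closed_sum => // i _.
by case: Pcl => _ _ PM; apply/PM/SP.
Qed.

Lemma ideal_gen_msupp P f :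
  ideal_closed P -> (forall m, m \in msupp f -> P 'X_[m]) -> P f.
Proof.
move=> Pcl Pf; rewrite [f]mpolyE big_seq.
apply: ideal_closed_sum => // m /Pf; rewrite -mul_mpolyC.
by case: Pcl => _ _; apply.
Qed.

Lemma msupp_closed (M : 'X_{1..n} -> Prop) :
  (forall m1 m2, M m1 -> M (m1 + m2)%MM) ->
  ideal_closed (fun f => forall m, m \in msupp f -> M m).
Proof.
move=> MD; split=> [m|f g Mf Mg m|c f Mf m].
- by rewrite msupp0.
- by move/msuppD_le; rewrite mem_cat => /orP[/Mf|/Mg].
- by move/msuppM_le/allpairsP=> [[m1 m2] /= [_ m2f ->]]; rewrite addmC; apply/MD/Mf.
Qed.

(** The condition on the support is preserved by the ideal operations and holds for the generators;
    conversely, each monomial of [f] is a multiple of a generator. *)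
Lemma monomial_ideal_genP (M : 'X_{1..n} -> Prop) f :
  ideal_gen (fun g => exists2 m, M m & g = 'X_[m]) f <->
  forall m, m \in msupp f -> exists2 u, M u & (u <= m)%MM.
Proof.
split.
  have Mcl : ideal_closed
      (fun g => forall m, m \in msupp g -> exists2 u, M u & (u <= m)%MM).
    apply: (@msupp_closed (fun m => exists2 u, M u & (u <= m)%MM)) => m1 m2 [u Mu le_u].
    by exists u => //; apply/(lepm_trans le_u)/lem_addr.
  apply: (ideal_gen_min Mcl) => _ [m Mm ->] m'.
  by rewrite msuppX inE => /eqP->; exists m => //; apply: lepm_refl.
move=> Mf; apply: ideal_gen_msupp => [|m /Mf[u Mu /submK <-]].
  exact: ideal_gen_closed.
rewrite mpolyXD; have [_ _] := @ideal_gen_closed (fun g => exists2 m, M m & g = 'X_[m]).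
by apply; apply: ideal_gen_incl; exists u.
Qed.

Lemma ideal_gen_eq S1 S2 :
  (forall f, S1 f <-> S2 f) -> ideal_eq (ideal_gen S1) (ideal_gen S2).
Proof.
move=> eqS f; split; apply: ideal_gen_min; try exact: ideal_gen_closed.
  by move=> g /eqS; apply: ideal_gen_incl.
by move=> g /eqS; apply: ideal_gen_incl.
Qed.

Lemma var_ideal_closed (J : {set 'I_n}) : ideal_closed (var_ideal k J).
Proof. exact: ideal_gen_closed. Qed.

Lemma var_idealP (J : {set 'I_n}) f :
  var_ideal k J f <-> forall m, m \in msupp f -> exists2 j, j \in J & m j != 0%N.
Proof.
have -> : var_ideal k J f <->
    ideal_gen (fun g => exists2 m, (exists2 j, j \in J & m = U_(j)%MM) & g = 'X_[m]) f.
  apply: ideal_gen_eq => g; split=> [[j jJ ->]|[_ [j jJ ->] ->]]; last by exists j.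
  by exists U_(j)%MM => //; exists j.
rewrite monomial_ideal_genP; split=> Jf m /Jf.
  by case=> _ [j jJ ->]; rewrite lep1mP; exists j.
by case=> j jJ; rewrite -lep1mP; exists U_(j)%MM => //; exists j.
Qed.

(** Each of the [a] factors contributes a variable of [J] to every monomial of a product.
    Conversely, variables of [J] are split off a monomial one at a time, by induction on [a]. *)
Lemma var_ideal_powP (J : {set 'I_n}) a f :
  ideal_pow (var_ideal k J) a f <->
  forall m, m \in msupp f -> (a <= \sum_(j in J) m j)%N.
Proof.
have deg_cl b : ideal_closed (fun f => forall m, m \in msupp f -> (b <= \sum_(j in J) m j)%N).
  apply: (@msupp_closed (fun m => (b <= \sum_(j in J) m j)%N)) => m1 m2 /leq_trans; apply.
  by apply: leq_sum => j _; rewrite mnmDE leq_addr.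
split.
  apply: (ideal_gen_min (deg_cl a)) => _ [g [gJ ->]].
  elim: a g gJ => [//|a IHa] g gJ m; rewrite big_ord_recl.
  move/msuppM_le/allpairsP=> [[m1 m2] /= [m1g m2g ->]].
  have /var_idealP/(_ _ m1g)[j jJ m1j] := gJ ord0.
  have /IHa/(_ _ m2g) := fun i => gJ (lift ord0 i).
  under [X in _ -> (_ <= X)%N]eq_bigr do rewrite mnmDE.
  rewrite big_split /= -add1n; apply: leq_add.
  by rewrite (bigD1 j) //= (leq_trans _ (leq_addr _ _)) // lt0n.
move=> Jf; apply: ideal_gen_msupp => [|m /Jf {Jf}]; first exact: ideal_gen_closed.
elim: a m => [|a IHa] m le_a.
  rewrite -['X_[m]]mulr1.
  have [_ _] := @ideal_gen_closed (fun f : R => exists g : 'I_0 -> R,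
    (forall i, var_ideal k J (g i)) /\ f = \prod_(i < 0) g i); apply.
  apply: ideal_gen_incl; exists (fun=> 0); split; first by case.
  by rewrite big_ord0.
have [j jJ mj] : exists2 j, j \in J & m j != 0%N.
  apply/exists_inP; apply: contraLR le_a; rewrite negb_exists_in => /forall_inP m0.
  by rewrite big1 // => j /m0; rewrite negbK => /eqP.
have Um : (U_(j) <= m)%MM by rewrite lep1mP.
have le_am : (a <= \sum_(i in J) (m - U_(j))%MM i)%N.
  move: le_a; rewrite -{1}(submK Um).
  under eq_bigr do rewrite mnmDE mnm1E.
  rewrite big_split /= [X in (_ + X)%N](bigD1 j) //= eqxx.
  rewrite [X in (_ + (_ + X))%N]big1 => [|i /andP[_]]; last by rewrite eq_sym => /negbTE->.
  by rewrite addn0 addn1 ltnS.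
have [r [c [g [gJ mE]]]] := IHa _ le_am.
rewrite -(submK Um) mpolyXD mulrC mE; exists r, c, (fun i => 'X_j * g i); split; last first.
  by rewrite mulr_sumr; apply: eq_bigr => i _; rewrite mulrCA.
move=> i; have [h [hJ ->]] := gJ i.
exists (fun t => if unlift ord0 t is Some t' then h t' else 'X_j); split.
  by move=> t; case: unlift => //; apply: ideal_gen_incl; exists j.
by rewrite big_ord_recl unlift_none; congr (_ * _); apply: eq_bigr => t _; rewrite liftK.
Qed.

(** Since membership in [I] depends only on the support, a homogeneous element of [I] is a
    combination of monomials of [I] of the same degree. *)
Lemma degree_idealE I (M : pred 'X_{1..n}) d :
  (forall f, I f <-> forall m, m \in msupp f -> M m) ->
  ideal_eq (degree_ideal I d)
    (ideal_gen (fun f => exists2 m, M m && (mdeg m == d) & f = 'X_[m])).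
Proof.
move=> IM f; split; apply: ideal_gen_min; try exact: ideal_gen_closed.
  move=> g [/IM Mg /dhomogP gd]; apply: ideal_gen_msupp; first exact: ideal_gen_closed.
  by move=> m mg; apply: ideal_gen_incl; exists m => //; rewrite Mg //=; apply/eqP/gd.
move=> _ [m /andP[Mm dm] ->]; apply: ideal_gen_incl; split; last by rewrite dhomogX.
by apply/IM => m'; rewrite msuppX inE => /eqP->.
Qed.

End IdealGen.

Arguments var_ideal_closed k {n} J.

(** * Linear quotients and their syzygies *)

Section LinearQuotients.
Set Implicit Arguments.
Unset Strict Implicit.
Import GRing.Theory.
Local Open Scope ring_scope.

Variables (k : fieldType) (n : nat).
Local Notation R := {mpoly k[n]}.

(** Lets the coefficients of a relation be replaced by one homogeneous component when all matrix
    entries have degree [e]. *)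
Lemma pihomogM d e (p q : R) :
  q \is e.-homog -> pihomog mdeg (d + e) (p * q) = pihomog mdeg d p * q.
Proof.
move=> qe; elim/mpolyind: p => [|c m p _ _ IHp]; first by rewrite mul0r !raddf0 mul0r.
rewrite mulrDl !raddfD /= mulrDl IHp -scalerAl !linearZ /= -scalerAl.
congr (_ *: _ + _); rewrite pihomogX; have [<-|d_neq] := eqVneq.
  by rewrite pihomog_dE // dhomogM // dhomogX.
rewrite mul0r (@pihomog_ne0 _ _ mdeg (mdeg m + e)) ?eqn_add2r //.
by rewrite dhomogM // dhomogX.
Qed.

Lemma dhomogU j : ('X_j : R) \is 1.-homog.
Proof. by rewrite dhomogX /= mdeg1. Qed.

Section SpanBelow.
Variables (m r : nat) (G : 'M[R]_(r, m)) (key : 'I_r -> nat).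

(** Rows are ordered by a numerical [key] instead of their index, so that syzygies can be ordered
    lexicographically without renumbering. *)
Definition span_below N (v : 'rV[R]_m) : Prop :=
  exists2 c : 'rV[R]_r, (forall l, (N <= key l)%N -> c 0 l = 0) & v = c *m G.

Lemma span_below0 N : span_below N 0.
Proof. by exists 0 => [l _|]; rewrite ?mxE ?mul0mx. Qed.

Lemma span_belowD N u v : span_below N u -> span_below N v -> span_below N (u + v).
Proof.
move=> [b b0 ->] [c c0 ->]; exists (b + c); last by rewrite mulmxDl.
by move=> l Nl; rewrite mxE b0 // c0 // addr0.
Qed.

Lemma span_belowZ N f v : span_below N v -> span_below N (f *: v).
Proof.
move=> [c c0 ->]; exists (f *: c); last by rewrite scalemxAl.
by move=> l Nl; rewrite mxE c0 // mulr0.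
Qed.

Lemma span_below_le M N v : (M <= N)%N -> span_below M v -> span_below N v.
Proof. by move=> MN [c c0 ->]; exists c => // l Nl; apply/c0/(leq_trans MN). Qed.

Lemma span_below_row N l : (key l < N)%N -> span_below N (row l G).
Proof.
move=> lN; exists (delta_mx 0 l); last by rewrite rowE.
move=> l' Nl'; rewrite mxE eqxx /=; case: eqP => // El.
by move: lN; rewrite -El ltnNge Nl'.
Qed.

Lemma span_below_ideal N u : ideal_closed (fun f => span_below N (f *: u)).
Proof.
split=> [|f g fu gu|c f fu]; first by rewrite scale0r; apply: span_below0.
  by rewrite scalerDl; apply: span_belowD.
by rewrite -scalerA; apply: span_belowZ.
Qed.

(* The colon ideal of row [l] by the rows of smaller [key] is [var_ideal k (V l)]. *)
Definition linear_quotients (V : 'I_r -> {set 'I_n}) : Prop :=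
  injective key /\
  forall l f, span_below (key l) (f *: row l G) <-> var_ideal k (V l) f.

(** A combination of earlier rows equal to ['X_j *: row l G] remains one when its coefficients are
    cut down to degree 1, as the entries of [G] have degree [e]; the difference of the two sides is
    the syzygy. *)
Lemma linear_relation e V l j :
    (forall l t, G l t \is e.-homog) -> linear_quotients V -> j \in V l ->
  exists h : 'rV[R]_r,
    [/\ h *m G = 0, h 0 l = 'X_j, forall l', (key l < key l')%N -> h 0 l' = 0
      & forall l', h 0 l' \is 1.-homog].
Proof.
move=> Ge [key_inj LQ] jV.
have [] : span_below (key l) ('X_j *: row l G).
  by apply/LQ/ideal_gen_incl; exists j.
move=> c c0 cE; pose c1 := map_mx (pihomog mdeg 1) c.
have c1E : 'X_j *: row l G = c1 *m G.
  apply/rowP => t; have := congr1 (fun A : 'rV_m => pihomog mdeg (1 + e) (A 0 t)) cE.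
  rewrite !mxE pihomog_dE => [->|]; last by rewrite dhomogM // dhomogU.
  by rewrite raddf_sum; apply: eq_bigr => i _ /=; rewrite pihomogM // mxE.
exists ('X_j *: delta_mx 0 l - c1); split.
- by rewrite mulmxBl -scalemxAl -rowE c1E subrr.
- by rewrite !mxE !eqxx mulr1 c0 // raddf0 subr0.
- move=> l' ltl; rewrite !mxE c0 ?(ltnW ltl) // raddf0 subr0 eqxx /=.
  by case: eqP ltl => [->|_]; rewrite ?ltnn // mulr0.
- move=> l'; rewrite !mxE eqxx /= rpredB ?pihomogP //.
  by case: eqP => _; rewrite ?mulr0 ?mulr1 ?rpred0 // dhomogU.
Qed.

End SpanBelow.

Section Syzygies.
Variables (m r : nat) (G : 'M[R]_(r, m)) (key : 'I_r -> nat).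
Variables (V : 'I_r -> {set 'I_n}).
Hypothesis GV : linear_quotients G key V.

Let P : {set 'I_r * 'I_n} := [set p | p.2 \in V p.1].
Local Notation pos q := (enum_val (A := P) q).1.
Local Notation var q := (enum_val (A := P) q).2.

Variable H : 'M[R]_(#|P|, r).
Hypothesis H_syz : H *m G = 0.
Hypothesis H_diag : forall q, H q (pos q) = 'X_(var q).
Hypothesis H_above : forall q l, (key (pos q) < key l)%N -> H q l = 0.

(** Encodes the lexicographic order on pairs (key of the position, variable): as [var q < n],
    quotient and remainder by [n] recover both components. *)
Let keyH (q : 'I_#|P|) : nat := (key (pos q) * n + var q)%N.

Let keyH_ge N q : (N * n <= keyH q)%N = (N <= key (pos q))%N.
Proof.
have n_gt0 : (0 < n)%N by apply: leq_ltn_trans (ltn_ord (var q)).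
by rewrite leqNgt /keyH -ltn_divLR // divnMDl // divn_small // addn0 -leqNgt.
Qed.

Let keyH_inj : injective keyH.
Proof.
move=> q q' eq_key; apply: (@enum_val_inj _ (mem P)).
have n_gt0 : (0 < n)%N by apply: leq_ltn_trans (ltn_ord (var q)).
have eq_var : var q = var q'.
  apply: val_inj; have := congr1 (modn^~ n) eq_key.
  by rewrite /keyH !modnMDl !modn_small.
have : pos q = pos q'.
  apply: GV.1; have := congr1 (divn^~ n) eq_key.
  by rewrite /keyH !divnMDl // !divn_small // !addn0.
by move: eq_var; case: (enum_val q) => ? ?; case: (enum_val q') => ? ? /= -> ->.
Qed.

Let span_syz N v : span_below H keyH N v -> v *m G = 0.
Proof. by case=> c _ ->; rewrite -mulmxA H_syz mulmx0. Qed.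

Let span_above N v l :
  span_below H keyH (N * n) v -> (N <= key l)%N -> v 0 l = 0.
Proof.
case=> c c0 -> Nl; rewrite mxE big1 // => q _.
have [Nq|qN] := leqP N (key (pos q)); first by rewrite c0 ?mul0r // keyH_ge.
by rewrite H_above ?mulr0 // (leq_trans qN).
Qed.

(** The entries at position [l] of the rows of [H] attached to [l] are the generating variables of
    the colon ideal, so combining these rows produces every element of it. *)
Let span_lead l f : var_ideal k (V l) f ->
  exists2 w, span_below H keyH ((key l).+1 * n) w & w 0 l = f.
Proof.
apply: (@ideal_gen_min _ _ _ (fun f =>
  exists2 w, span_below H keyH ((key l).+1 * n) w & w 0 l = f)).
  split=> [|_ _ [v vl <-] [w wl <-]|c _ [w wl <-]].
  - by exists 0; [apply: span_below0 | rewrite mxE].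
  - by exists (v + w); [apply: span_belowD | rewrite mxE].
  - by exists (c *: w); [apply: span_belowZ | rewrite mxE].
move=> _ [j jV ->].
have ljP : (l, j) \in P by rewrite inE.
pose q := enum_rank_in ljP (l, j).
have qE : enum_val q = (l, j) by rewrite enum_rankK_in.
exists (row q H); last by rewrite mxE; have := H_diag q; rewrite qE.
by apply: span_below_row; rewrite ltnNge keyH_ge qE /= ltnn.
Qed.

(** Reduction by leading terms, by induction on [N]: the last possibly nonzero entry of a syzygy
    lies in the colon ideal of its position, so a combination of rows of [H] with the same entry
    there can be subtracted. *)
Let syz_below N (v : 'rV[R]_r) :
    v *m G = 0 -> (forall l, (N <= key l)%N -> v 0 l = 0) ->
  span_below H keyH (N * n) v.
Proof.
elim: N v => [|N IHN] v vG v0.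
  have -> : v = 0 by apply/rowP => l; rewrite v0 ?mxE.
  exact: span_below0.
have [l /eqP lN|noN] := pickP (fun l => key l == N); last first.
  apply: span_below_le (IHN v vG _) => [|l Nl]; first by rewrite leq_mul2r leqnSn orbT.
  by apply: v0; rewrite ltn_neqAle eq_sym noN.
have vl : var_ideal k (V l) (v 0 l).
  (* As [v *m G = 0], this vector is mapped to [v 0 l *: row l G], and it vanishes from key [N]
     on. *)
  apply/GV.2; exists (v 0 l *: delta_mx 0 l - v); last first.
    by rewrite mulmxBl vG subr0 -scalemxAl -rowE.
  move=> l'; rewrite leq_eqVlt => /predU1P[/GV.1 <-|lt_l].
    by rewrite !mxE !eqxx mulr1 subrr.
  rewrite !mxE (v0 l') -?lN // subr0 eqxx /=.
  by case: eqP lt_l => [->|_]; rewrite ?ltnn // mulr0.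
have [w w_span wl] := span_lead vl; rewrite lN in w_span.
rewrite -(subrK w v) addrC; apply: span_belowD => //.
apply: span_below_le (IHN (v - w) _ _).
- by rewrite leq_mul2r leqnSn orbT.
- by rewrite mulmxBl vG (span_syz w_span) subrr.
- move=> l'; rewrite -lN leq_eqVlt => /predU1P[/GV.1 <-|lt_l].
    by rewrite !mxE wl subrr.
  by rewrite lN in lt_l; rewrite !mxE v0 // (span_above w_span) // subrr.
Qed.

Lemma syz_generated (v : 'rV[R]_r) : v *m G = 0 <-> exists w, v = w *m H.
Proof.
split=> [vG|[w ->]]; last by rewrite -mulmxA H_syz mulmx0.
(* A bound above all keys makes the vanishing condition vacuous. *)
have [] := @syz_below (\max_l key l).+1 v vG; last by move=> w _ ->; exists w.
by move=> l; rewrite ltnNge leq_bigmax.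
Qed.

(* The row (k, j) of [H] has leading term [x_j] at position [k], so its colon
   ideal is contained in (x_j' : j' < j) : x_j; equality follows from the
   relation x_j' (k, j) - x_j (k, j'), which vanishes at position [k]. *)
Lemma syz_linear_quotients :
  linear_quotients H keyH (fun q => [set j in V (pos q) | (j < var q)%N]).
Proof.
split=> // q f; split=> [[c c0 cE]|].
  (* Entries at [pos q] are compared: an earlier row has there either 0 or, if it shares the
     position, a smaller variable. *)
  have fX : var_ideal k [set j in V (pos q) | (j < var q)%N] (f * 'X_(var q)).
    have := congr1 (fun v : 'rV_r => v 0 (pos q)) cE.
    rewrite !mxE H_diag => ->.
    apply: ideal_closed_sum => [|q' _]; first exact: ideal_gen_closed.
    have [I0 _ IM] := var_ideal_closed k [set j in V (pos q) | (j < var q)%N].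
    have [/c0->|lt_q] := leqP (keyH q) (keyH q'); first by rewrite mul0r.
    have [lt_pos|] := ltnP (key (pos q')) (key (pos q)).
      by rewrite H_above // mulr0.
    rewrite leq_eqVlt => /predU1P[/GV.1 eq_pos|gt_pos]; last first.
      move: lt_q; rewrite ltnNge (leq_trans _ (_ : (key (pos q')) * n <= _)%N) //.
        rewrite /keyH (leq_trans _ (leq_mul gt_pos (leqnn n))) //.
        by rewrite mulSn addnC leq_add2r ltnW.
      by rewrite keyH_ge.
    rewrite [in H q' _]eq_pos H_diag; apply/IM/ideal_gen_incl; exists (var q') => //.
    rewrite inE eq_pos; have := enum_valP q'; rewrite inE => -> /=.
    by move: lt_q; rewrite /keyH eq_pos ltn_add2l.
  (* [var q] itself is not in the set, so cancelling this variable leaves the monomial in the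
     ideal. *)
  apply/var_idealP => u uf; have /var_idealP/(_ (U_(var q) + u)%MM) := fX.
  case=> [|j]; first by rewrite (perm_mem (msuppMX _ _)) map_f.
  move=> jV uj; exists j => //; move: uj; rewrite mnmDE mnm1E.
  by case: (var q =P j) jV => // <-; rewrite inE ltnn andbF.
apply: (ideal_gen_min (span_below_ideal _ _ _ _)) => _ [j + ->].
rewrite inE => /andP[jV lt_j].
have qjP : (pos q, j) \in P by rewrite inE.
pose q' := enum_rank_in qjP (pos q, j).
have q'E : enum_val q' = (pos q, j) by rewrite enum_rankK_in.
rewrite -(subrK ('X_(var q) *: row q' H) ('X_j *: row q H)).
apply: span_belowD; last first.
  by apply/span_belowZ/span_below_row; rewrite /keyH q'E ltn_add2l.
apply: (@span_below_le _ _ _ _ (key (pos q) * n)); first by rewrite keyH_ge.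
apply: syz_below => [|l].
  by rewrite mulmxBl -!scalemxAl -!row_mul H_syz !row0 !scaler0 subrr.
rewrite leq_eqVlt => /predU1P[/GV.1 <-|lt_l]; last first.
  by rewrite !mxE !H_above ?q'E // !mulr0 subrr.
rewrite !mxE H_diag; have := H_diag q'; rewrite q'E => ->.
by rewrite mulrC subrr.
Qed.

End Syzygies.

Lemma linear_syzygies m r (G : 'M[R]_(r, m)) e key V :
    (forall l t, G l t \is e.-homog) -> linear_quotients G key V ->
  exists r' (H : 'M[R]_(r', r)) key' V',
    [/\ forall l t, H l t \is 1.-homog, linear_quotients H key' V'
      & forall v : 'rV[R]_r, v *m G = 0 <-> exists w, v = w *m H].
Proof.
move=> Ge GV; pose P : {set 'I_r * 'I_n} := [set p | p.2 \in V p.1].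
have /fin_all_exists[h hP] (q : 'I_#|P|) := linear_relation Ge GV
  (etrans (esym (in_set _ _)) (enum_valP q) : (enum_val q).2 \in V (enum_val q).1).
pose H : 'M[R]_(#|P|, r) := \matrix_q h q.
have H_syz : H *m G = 0.
  by apply/row_matrixP => q; rewrite row_mul rowK row0; case: (hP q).
have H_diag q : H q (enum_val q).1 = 'X_(enum_val q).2 by rewrite mxE; case: (hP q).
have H_above q l : (key (enum_val q).1 < key l)%N -> H q l = 0.
  by rewrite mxE; case: (hP q) => _ _ h0 _; apply: h0.
exists #|P|, H; do 2!eexists; split.
- by move=> q l; rewrite mxE; case: (hP q).
- exact: syz_linear_quotients GV H H_syz H_diag H_above.
- by move=> v; apply: syz_generated GV H H_syz H_diag H_above v.
Qed.

End LinearQuotients.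

(** * Linear resolutions from linear quotients *)

Section LinearResolution.
Set Implicit Arguments.
Unset Strict Implicit.
Import Order.TTheory GRing.Theory.
Local Open Scope ring_scope.

Variables (k : fieldType) (n : nat).
Local Notation R := {mpoly k[n]}.

(** Bundles the property inherited by syzygies; the column number is a parameter, so that the rows
    of one matrix index the columns of the next. *)
Record lq_matrix (m : nat) := LqMatrix {
  lq_rows : nat;
  lq_mx :> 'M[R]_(lq_rows, m);
  lq_deg : nat;
  lq_homog : forall l t, lq_mx l t \is lq_deg.-homog;
  lq_quotients : exists key V, linear_quotients lq_mx key V
}.

Lemma lq_syzygies m (G : lq_matrix m) :
  exists H : lq_matrix (lq_rows G),
    lq_deg H = 1%N /\
    forall v : 'rV[R]_(lq_rows G), v *m G = 0 <-> exists w, v = w *m H.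
Proof.
have [key [V GV]] := lq_quotients G.
have [r' [H [key' [V' [H1 HV Hsyz]]]]] := linear_syzygies (@lq_homog _ G) GV.
by exists (LqMatrix H1 (ex_intro _ _ (ex_intro _ _ HV))).
Qed.

(** Indefinite description turns the existence of a syzygy matrix into data, as the complex
    requires. *)
Definition lq_next m (G : lq_matrix m) : lq_matrix (lq_rows G) :=
  proj1_sig (ClassicalEpsilon.constructive_indefinite_description _ (lq_syzygies G)).

Lemma lq_nextP m (G : lq_matrix m) :
  lq_deg (lq_next G) = 1%N /\
  forall v : 'rV[R]_(lq_rows G), v *m G = 0 <-> exists w, v = w *m lq_next G.
Proof. by rewrite /lq_next; case: ClassicalEpsilon.constructive_indefinite_description. Qed.

Definition lq_stage (G : lq_matrix 1) (i : nat) : {m & lq_matrix m} :=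
  iter i (fun s => Tagged lq_matrix (lq_next (tagged s))) (Tagged lq_matrix G).

Definition lq_complex (G : lq_matrix 1) (d : nat) : free_complex k n :=
  @FreeComplex k n (fun i => lq_rows (tagged (lq_stage G i))) (fun i _ => (i + d)%N)
    (fun i => lq_mx (tagged (lq_stage G i.+1))) (lq_mx G).

(** Exactness holds by the choice of each stage. The entries of the differentials are homogeneous of
    degree 1, hence without constant term, which gives minimality. *)
Lemma lq_complex_resolution (G : lq_matrix 1) (I : R -> Prop) :
    (forall f, I f <-> exists v : 'rV[R]_(lq_rows G), f = (v *m G) 0 0) ->
  minimal_graded_resolution (lq_complex G (lq_deg G)) I.
Proof.
move=> IG.
have diff_homog i l t : diff (lq_complex G (lq_deg G)) i l t \is 1.-homog.
  have := @lq_homog _ (lq_next (tagged (lq_stage G i))) l t.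
  by rewrite (lq_nextP (tagged (lq_stage G i))).1.
split.
- split=> [l|i l t _] /=; first exact: lq_homog.
  by rewrite addSn leqnSn subSnn; split=> //; apply: diff_homog.
- split=> // [|i].
    exact: (lq_nextP G).2.
  exact: (lq_nextP (tagged (lq_stage G i.+1))).2.
- move=> i l t; apply/var_idealP => m /(dhomog_mf (diff_homog i l t)) /= /eqP.
  by case/mdeg1P=> j /eqP->; exists j; rewrite ?inE // mnm1E eqxx.
Qed.

Lemma lq_linear_resolution (G : lq_matrix 1) (I : R -> Prop) :
    (forall f, I f <-> exists v : 'rV[R]_(lq_rows G), f = (v *m G) 0 0) ->
  linear_resolution I (lq_deg G).
Proof.
move=> IG; split.
  exists (fun f => exists l, f = G l 0) => [_ [l ->]|f]; first exact: lq_homog.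
  rewrite IG; split=> [[v ->]|].
    exists (lq_rows G), (fun l => v 0 l), (fun l => G l 0).
    by split=> [l|]; [exists l | rewrite mxE].
  move=> [r [c [g [gG ->]]]]; have [s sP] := fin_all_exists gG.
  exists (\sum_i c i *: delta_mx 0 (s i)).
  rewrite mulmx_suml summxE; apply: eq_bigr => i _.
  by rewrite -scalemxAl -rowE !mxE -sP.
move=> i j ne_j; exists (lq_complex G (lq_deg G)); first exact: lq_complex_resolution.
(* All shifts in homological degree [i] equal [i + lq_deg G], which differs from [j]. *)
apply/esym/eqP; rewrite cards_eq0; apply/eqP/setP => l; rewrite !inE /=.
by apply/eqP => ji; apply: ne_j.
Qed.

(** * Linear quotients and polymatroidality from the exchange property *)

Section Exchange.
Variables (M : pred 'X_{1..n}) (d : nat).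
Hypothesis M_deg : forall u, M u -> mdeg u = d.
Hypothesis M_exchange : forall u v, M u -> M v -> forall i, (v i < u i)%N ->
  exists2 j, (u j < v j)%N & M (u - U_(i) + U_(j))%MM.

(** Bounding the degree makes the monomials a finite type; as those in [M] all have degree [d], the
    sort is lexicographic. *)
Let s : seq 'X_{1..n} :=
  sort <=%O [seq val u | u <- enum {: 'X_{1..n < d.+1}} & M (val u)].

Let mem_s u : (u \in s) = M u.
Proof.
rewrite mem_sort; apply/mapP/idP => [[w + ->]|Mu]; first by rewrite mem_filter => /andP[].
have u_lt : (mdeg u < d.+1)%N by rewrite M_deg.
by exists (BMultinom u_lt) => //; rewrite mem_filter /= Mu mem_enum.
Qed.

Local Notation mon l := (nth 0%MM s l).

Let mon_in (l : 'I_(size s)) : M (mon l).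
Proof. by rewrite -mem_s mem_nth. Qed.

Let mon_lt (l l' : 'I_(size s)) : (mon l < mon l')%O = (l < l')%N.
Proof.
apply: lt_sorted_ltn_nth; rewrite ?inE //.
rewrite sort_lt_sorted map_inj_uniq; last exact: val_inj.
exact/filter_uniq/enum_uniq.
Qed.

Let G : 'M[R]_(size s, 1) := \matrix_(l < size s, t < 1) 'X_[mon l].

Let V (l : 'I_(size s)) : {set 'I_n} :=
  [set j | [exists l' : 'I_(size s), (l' < l)%N && (mon l' <= mon l + U_(j))%MM]].

(* If x^m u is divisible by a lexicographically smaller u' in M, with first
   difference at i, then exchanging x_i in u for some x_j with u j < u' j gives
   an element of M preceding u, so that j is in the colon set of u and in m. *)
Let exchange_quotients : linear_quotients G val V.
Proof.
split=> [|l f]; first exact: val_inj.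
split=> [[c c0 cE]|].
  apply/var_idealP => m mf.
  pose L := ideal_gen (fun g : R =>
    exists2 u, exists2 l' : 'I_(size s), (l' < l)%N & u = mon l' & g = 'X_[u]).
  have : L (f * 'X_[mon l]).
    have := congr1 (fun v : 'rV_1 => v 0 0) cE; rewrite !mxE => ->.
    have L_cl : ideal_closed L by apply: ideal_gen_closed.
    apply: ideal_closed_sum => // l' _; have [L0 _ LM] := L_cl.
    have [/c0->|lt_l] := leqP l l'; first by rewrite mul0r.
    by rewrite mxE; apply/LM/ideal_gen_incl; exists (mon l') => //; exists l'.
  move/monomial_ideal_genP/(_ (mon l + m)%MM).
  case=> [|_ [l' lt_l ->] le_m]; first by rewrite (perm_mem (msuppMX _ _)) map_f.
  have deg_l : mdeg (mon l') = mdeg (mon l) by rewrite !M_deg.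
  have /(ltmcP deg_l)[i eq_i lt_i] : (mon l' < mon l)%O by rewrite mon_lt.
  have [j lt_j Mw] := M_exchange (mon_in l) (mon_in l') lt_i.
  have lt_ij : (i < j)%N.
    rewrite ltnNge leq_eqVlt negb_or -leqNgt.
    apply/andP; split; first by apply: contraTneq lt_j => /val_inj->; rewrite -leqNgt ltnW.
    by rewrite leqNgt; apply: contraTN lt_j => /eq_i->; rewrite ltnn.
  exists j; last first.
    have := mnm_lepP le_m j; rewrite mnmDE => le_j.
    by apply: contraTneq (leq_trans lt_j le_j) => ->; rewrite addn0 ltnn.
  set w := (mon l - U_(i) + U_(j))%MM in Mw.
  have w_lt : (index w s < size s)%N by rewrite index_mem mem_s.
  have wE : mon (Ordinal w_lt) = w by rewrite /= nth_index ?mem_s.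
  rewrite inE; apply/existsP; exists (Ordinal w_lt); rewrite -mon_lt wE.
  apply/andP; split; last first.
    by apply/mnm_lepP => t; rewrite !mnmDE mnmBE leq_add2r leq_subr.
  have deg_w : mdeg w = mdeg (mon l) by rewrite !M_deg.
  apply/(ltmcP deg_w); exists i => [t lt_t|].
    rewrite mnmDE mnmBE !mnm1E.
    have jt : (j == t) = false := gtn_eqF (ltn_trans lt_t lt_ij).
    by rewrite jt (gtn_eqF lt_t : (i == t) = false) subn0 addn0.
  rewrite mnmDE mnmBE !mnm1E eqxx (gtn_eqF lt_ij : (j == i) = false) addn0 subn1.
  by rewrite prednK // (leq_ltn_trans _ lt_i).
apply: (ideal_gen_min (span_below_ideal _ _ _ _)) => _ [j + ->].
rewrite inE => /existsP[l' /andP[lt_l le_l]].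
have -> : 'X_j *: row l G = 'X_[mon l + U_(j) - mon l'] *: row l' G.
  by apply/rowP => t; rewrite !mxE -!mpolyXD submK // addmC.
exact/span_belowZ/span_below_row.
Qed.

Lemma exchange_linear_resolution (I : R -> Prop) :
    ideal_eq I (ideal_gen (fun f => exists2 u, M u & f = 'X_[u])) ->
  linear_resolution I d.
Proof.
move=> IM.
have Gd l t : G l t \is d.-homog by rewrite mxE dhomogX /= M_deg.
pose A := LqMatrix Gd (ex_intro _ _ (ex_intro _ _ exchange_quotients)).
apply: (@lq_linear_resolution A) => f; rewrite IM; split=> [|[v ->]]; last first.
  rewrite mxE; exists (size s), (fun l => v 0 l), (fun l => 'X_[mon l]).
  split=> [l|]; first by exists (mon l).
  by apply: eq_bigr => l _; rewrite mxE.
apply: (@ideal_gen_min _ _ _ (fun f => exists v : 'rV[R]_(size s), f = (v *m G) 0 0)).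
  split=> [|_ _ [u ->] [v ->]|c _ [v ->]].
  - by exists 0; rewrite mul0mx mxE.
  - by exists (u + v); rewrite mulmxDl [RHS]mxE.
  - by exists (c *: v); rewrite -scalemxAl [RHS]mxE.
move=> _ [u Mu ->]; have u_lt : (index u s < size s)%N by rewrite index_mem mem_s.
by exists (delta_mx 0 (Ordinal u_lt)); rewrite -rowE !mxE nth_index ?mem_s.
Qed.

Lemma exchange_polymatroidal (I : R -> Prop) :
    ideal_eq I (ideal_gen (fun f => exists2 u, M u & f = 'X_[u])) ->
  polymatroidal I.
Proof.
move=> IM; split.
- by exists M.
- exists d, (fun f => exists2 u, M u & f = 'X_[u]) => // _ [u Mu ->].
  by rewrite dhomogX /= M_deg.
have MI u : M u -> I 'X_[u] by move=> Mu; apply/IM/ideal_gen_incl; exists u.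
(* A minimal generator is divisible by an element of [M], which lies in [I], hence is equal to
   it. *)
have gen_M u : min_monomial_gen I u -> M u.
  case=> /IM/monomial_ideal_genP/(_ u); rewrite msuppX inE eqxx.
  by case=> // w Mw le_w min_u; rewrite -(min_u w (MI _ Mw) le_w).
move=> u v /gen_M Mu /gen_M Mv i lt_i.
by have [j lt_j Mw] := M_exchange Mu Mv lt_i; exists j => //; apply: MI.
Qed.

End Exchange.
End LinearResolution.

(** * Exchange for monomials under lower degree bounds *)

Section Exchange.
Set Implicit Arguments.
Unset Strict Implicit.

(* The complements of the [J t] are pairwise disjoint, and in degree [d] the
   constraints on [u] bound its degrees on these complements from above. If no
   admissible [j] existed, then [u j >= v j] would hold off the union [W] of the
   complements whose bound [u] attains and which do not contain [i], strictly
   at [i], whereas the degree of [u] on [W] is maximal. *)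
Lemma exchange_of_disjoint_complements (n s d : nat) (J : 'I_s -> {set 'I_n})
    (a : 'I_s -> nat) (u v : 'X_{1..n}) (i : 'I_n) :
    (forall p q : 'I_s, p != q -> J p :|: J q = [set: 'I_n]) ->
    mdeg u = d -> mdeg v = d ->
    (forall t, a t <= \sum_(j in J t) u j) ->
    (forall t, a t <= \sum_(j in J t) v j) -> v i < u i ->
  exists2 j : 'I_n, u j < v j &
    forall t, a t <= \sum_(l in J t) (u - U_(i) + U_(j))%MM l.
Proof.
move=> hJ du dv au av lt_i.
(* These are the bounds that removing a factor ['X_i] would violate; [j] has to lie in each of their
   sets [J t]. *)
pose T := [pred t | (i \in J t) && (\sum_(j in J t) u j == a t)].
have [j /andP[lt_j /forall_inP jT]|no_j] :=
    pickP [pred j | (u j < v j) && [forall (t | T t), j \in J t]].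
  exists j => // t; set w := (_ + _)%MM.
  (* Adding [U_(i)] back avoids the truncated subtraction in [w]. *)
  have uw : (w + U_(i) = u + U_(j))%MM.
    rewrite /w -addmA [(U_(j) + _)%MM]addmC addmA submK // lep1mP.
    by rewrite -lt0n (leq_ltn_trans _ lt_i).
  have sumU x : \sum_(l in J t) U_(x)%MM l = (x \in J t).
    have [xJ|xJ] := boolP (x \in J t).
      rewrite (bigD1 x) //= mnm1E eqxx big1 // => l /andP[_ /negbTE].
      by rewrite mnm1E eq_sym => ->.
    by rewrite big1 // => l lJ; rewrite mnm1E; case: eqP lJ xJ => // -> ->.
  have: \sum_(l in J t) w l + (i \in J t) = \sum_(l in J t) u l + (j \in J t).
    rewrite -!sumU -!big_split /=; apply: eq_bigr => l _.
    by rewrite -!mnmDE uw.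
  have := jT t; rewrite /= /T /=; have := au t; rewrite leq_eqVlt eq_sym.
  case: (i \in J t) => /=; last first.
    by rewrite addn0 => _ _ ->; apply: (leq_trans (au t)); apply: leq_addr.
  case: eqP => [<- _ /(_ isT)-> | _ /= lt_a _ eq_w]; first by move/addIn->.
  by rewrite -(leq_add2r 1) eq_w addn1 (leq_trans lt_a) ?leq_addr.
pose F t := if T t then ~: J t else set0.
pose W := \bigcup_t F t.
have F_disj p q : p != q -> [disjoint F p & F q].
  move=> /hJ/setP JT; rewrite -setI_eq0; apply/eqP/setP => x; rewrite /F.
  by have := JT x; case: ifP => _; case: ifP => _; rewrite !inE ?andbF // -negb_or => ->.
have split_W (m : 'X_{1..n}) :
    mdeg m = \sum_t \sum_(j in F t) m j + \sum_(j in ~: W) m j.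
  rewrite mdegE (bigID (mem W)) /= (partition_disjoint_bigcup _ _ F_disj).
  by congr (_ + _); apply: eq_bigl => j; rewrite !inE.
have : \sum_(j in ~: W) v j < \sum_(j in ~: W) u j.
  have iW : i \in ~: W.
    rewrite inE; apply/bigcupP => [[t _]]; rewrite /F.
    by case: ifP => [/andP[iJ _]|_]; rewrite inE ?iJ.
  rewrite (bigD1 i) // [ltnRHS](bigD1 i) //= -addSn leq_add // leq_sum // => j /andP[jW _].
  rewrite leqNgt; apply/negP => lt_j; have := no_j j; rewrite /= lt_j /=.
  move/negbT; rewrite negb_forall_in => /exists_inP[t Tt jJ].
  by move: jW; rewrite inE => /bigcupP[]; exists t => //; rewrite /F ifT ?inE.
have : \sum_t \sum_(j in F t) v j <= \sum_t \sum_(j in F t) u j.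
  apply: leq_sum => t _; rewrite /F; case: ifP => [/andP[_ /eqP ut]|_]; last first.
    by rewrite !big_set0.
  have: \sum_(j in J t) u j + \sum_(j in ~: J t) u j =
        \sum_(j in J t) v j + \sum_(j in ~: J t) v j.
    have deg_split (m : 'X_{1..n}) :
        mdeg m = \sum_(j in J t) m j + \sum_(j in ~: J t) m j.
      rewrite mdegE (bigID (mem (J t))) /=.
      by congr (_ + _); apply: eq_bigl => j; rewrite inE.
    by rewrite -!deg_split du dv.
  rewrite ut => E; rewrite -(leq_add2l (a t)) E leq_add2r; exact: av.
have := split_W u; have := split_W v; rewrite du dv => -> E leW ltW.
by have := leq_add leW ltW; rewrite addnS E ltnn.
Qed.
End Exchange.

(** * The intersection of powers of variable ideals *)

Theorem theorem3p1 (k : fieldType) (n s : nat) (hn : (1 <= n)%N) (hs : (1 <= s)%N)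
    (J : 'I_s -> {set 'I_n}) (a : 'I_s -> nat)
    (hJ0 : forall i : 'I_s, J i != set0)
    (hJ : forall i j : 'I_s, i != j -> J i :|: J j = [set: 'I_n])
    (ha : forall i : 'I_s, (0 < a i)%N) :
  let I := ideal_inter (fun i : 'I_s => ideal_pow (var_ideal k (J i)) (a i)) in
  (forall d : nat, polymatroidal (degree_ideal I d)) /\ componentwise_linear I.
Proof.
move=> I; pose M := [pred u : 'X_{1..n} | [forall t, a t <= \sum_(j in J t) u j]].
have IM f : I f <-> forall m, m \in msupp f -> M m.
  split=> [If m mf|Mf t]; first by apply/forallP => t; apply: (var_ideal_powP _ _ _).1 mf.
  by apply/var_ideal_powP => m /Mf/forallP.
pose Md d := [pred u | M u && (mdeg u == d)].
have Md_deg d u : Md d u -> mdeg u = d by case/andP=> _ /eqP.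
have Md_exchange d u v : Md d u -> Md d v -> forall i, v i < u i ->
    exists2 j, u j < v j & Md d (u - U_(i) + U_(j))%MM.
  move=> /andP[/forallP au /eqP du] /andP[/forallP av /eqP dv] i lt_i.
  have [j lt_j aw] := exchange_of_disjoint_complements hJ du dv au av lt_i.
  exists j => //; apply/andP; split; first exact/forallP.
  have Ui : (U_(i) <= u)%MM by rewrite lep1mP -lt0n (leq_ltn_trans _ lt_i).
  by rewrite -du -{2}(submK Ui) !mdegD !mdeg1.
have IdM d : ideal_eq (degree_ideal I d)
    (ideal_gen (fun f => exists2 u, Md d u & f = 'X_[u]%R)).
  exact: degree_idealE.
split=> [d|]; first exact: (exchange_polymatroidal (Md_deg d) (@Md_exchange d)).
split=> [|d]; last exact: (exchange_linear_resolution (Md_deg d) (@Md_exchange d)).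
(* [I] is homogeneous because it is generated by its monomials. *)
exists (fun f => exists2 m, M m & f = 'X_[m]%R) => [_ [m _ ->]|f].
  by exists (mdeg m); rewrite dhomogX.
rewrite IM monomial_ideal_genP; split=> Mf m /Mf; first by exists m; rewrite ?lepm_refl.
case=> u /forallP au /mnm_lepP le_u; apply/forallP => t.
by apply: leq_trans (au t) _; apply: leq_sum.
Qed.
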